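(* Let $(V,m,b)$ be an infinite weighted directed graph satisfying the standing assumptions (locally finite, weakly connected, $\sum_{y}b(x,y)>0$ for all $x$, and Kirchhoff's assumption), and let $\Delta=H+B$ be the decomposition of its Laplacian into symmetric part $H=\frac12(\Delta+\Delta')$ and skew-symmetric part $B=\frac12(\Delta-\Delta')$ on $\mathcal C_c(V)$. If $H$ is essentially self-adjoint and $B$ is relatively bounded with respect to $H$ with relative norm smaller than $1/2$, then $\overline{\Delta}$ is m-accretive.
   Context: Graph: $V$ is a countable set, $b:V\times V\to[0,\infty)$ satisfies $b(x,x)=0$ for all $x$, and $m:V\to(0,\infty)$ is a weight on vertices. For $x\in V$, $V_x=\{y\in V: b(x,y)>0\text{ or }b(y,x)>0\}$. Standing assumptions: (1) locally finite: every $V_x$ is finite; (2) weakly connected: any two vertices are joined by a finite chain of undirected edges $\{x,y\}$ (pairs with $b(x,y)>0$ or $b(y,x)>0$); (3) $\sum_{y\in V}b(x,y)>0$ for all $x\in V$; (4) Kirchhoff's assumption: $\sum_{y}b(x,y)=\sum_{y}b(y,x)$ for all $x\in V$. Function spaces: $\mathcal C_c(V)$ is the set of finitely supported functions $V\to\mathbb C$; $\ell^2(V,m)$ is the Hilbert space of $f:V\to\mathbb C$ with $\sum_x m(x)|f(x)|^2<\infty$, with scalar product $\langle f,g\rangle=\sum_x m(x)f(x)\overline{g(x)}$. Operators on $\ell^2(V,m)$ with domain $\mathcal C_c(V)$: $\Delta f(x)=\frac{1}{m(x)}\sum_{y}b(x,y)(f(x)-f(y))$ and its formal adjoint $\Delta'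 f(x)=\frac{1}{m(x)}\sum_{y}b(y,x)(f(x)-f(y))$; $H$ and $B$ have domain $\mathcal C_c(V)$. $\Delta$ is closable, with closure $\overline{\Delta}$. ''$H$ is essentially self-adjoint'' means its closure in $\ell^2(V,m)$ is self-adjoint. ''$B$ is relatively bounded with respect to $H$ with relative norm smaller than $1/2$'' means there exist constants $C>0$ and $0<a<1/2$ such that $\|Bf\|\le C\|f\|+a\|Hf\|$ for all $f\in\mathcal C_c(V)$. An operator $A$ with domain $D(A)$ is accretive if $\operatorname{Re}\langle Af,f\rangle\ge 0$ for all $f\in D(A)$. An accretive operator $A$ is m-accretive if the open left half-plane is contained in its resolvent set and $\|(A+\lambda)^{-1}\|\le \frac{1}{\operatorname{Re}\lambda}$ for all $\lambda$ with $\operatorname{Re}\lambda>0$. *)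

(* Defs.v *)
From HB Require Import structures.
From mathcomp Require Import all_boot all_order all_algebra.
From mathcomp Require Import finmap complex.
From mathcomp Require Import all_classical all_reals all_analysis.
From mathcomp Require Import ring lra.

Set Implicit Arguments.
Unset Strict Implicit.
Unset Printing Implicit Defensive.

Import Order.TTheory GRing.Theory Num.Theory.
Import numFieldNormedType.Exports.
Import Normc.

Local Open Scope classical_set_scope.
Local Open Scope ring_scope.
Local Open Scope complex_scope.

Record wdigraph (R : realType) (V : countType) := WDigraph {
  edge_weight :> V -> V -> R;
  vweight : V -> R;
  edge_weight_ge0 : forall x y, 0 <= edge_weight x y;
  edge_weight_diag : forall x, edge_weight x x = 0;
  vweight_gt0 : forall x, 0 < vweight x }.

Section assumptions.
Context (R : realType) (V : countType) (b : wdigraph R V).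

Definition adjacent : rel V := fun x y => (0 < b x y) || (0 < b y x).

Definition locally_finite := forall x, finite_set [set y | adjacent x y].

Definition weakly_connected :=
  forall x y, exists2 p : seq V, path adjacent x p & last x p = y.

(* Sums over [set: V] written with \in are finitely supported sums (by
   convention they vanish when the support is infinite); local finiteness
   makes the supports below finite. *)
Definition pos_outdegree := forall x, 0 < \sum_(y \in [set: V]) b x y.

Definition kirchhoff :=
  forall x, \sum_(y \in [set: V]) b x y = \sum_(y \in [set: V]) b y x.

End assumptions.

Section l2_predicate.
Context (R : realType) (V : countType) (b : wdigraph R V).
Local Notation C := R[i].
Local Notation m := (vweight b).

Definition sqnorm (f : V -> C) : \bar R :=
  \esum_(x in [set: V]) (m x * normc (f x) ^+ 2)%:E.

Definition l2pred : {pred V -> C} := mem [set f | (sqnorm f < +oo)%E].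

Lemma sqterm_ge0 (f : V -> C) x : (0 <= (m x * normc (f x) ^+ 2)%:E)%E.
Proof. by rewrite lee_fin mulr_ge0 ?sqr_ge0 ?ltW ?vweight_gt0. Qed.

Lemma sqnorm_ge0 f : (0 <= sqnorm f)%E.
Proof. by apply: esum_ge0 => x _; exact: sqterm_ge0. Qed.

Lemma esumZ (c : R) (a : V -> R) : 0 <= c -> (forall x, 0 <= a x) ->
  (\esum_(x in [set: V]) (c * a x)%:E =
   c%:E * \esum_(x in [set: V]) (a x)%:E)%E.
Proof.
move=> c0 a0.
have le1 (d : R) (e : V -> R) : 0 <= d -> (forall x, 0 <= e x) ->
  (\esum_(x in [set: V]) (d * e x)%:E <=
   d%:E * \esum_(x in [set: V]) (e x)%:E)%E.
  move=> d0 e0; apply: ge_ereal_sup => _ [A [finA _] <-].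
  under eq_fsbigr do rewrite EFinM.
  rewrite -ge0_mule_fsumr; last by move=> x; rewrite lee_fin.
  by apply: lee_wpmul2l; rewrite ?lee_fin//; apply: ereal_sup_ubound; exists A.
apply/eqP; rewrite eq_le le1//=.
move: c0; rewrite (le_eqVlt 0 c) => /predU1P[<-|c0].
  by rewrite mul0e; apply: esum_ge0 => x _; rewrite lee_fin mul0r.
rewrite muleC -lee_pdivlMr// muleC.
apply: le_trans (le1 c^-1 (fun x => c * a x) _ _).
- by apply: le_esum => x _; rewrite lee_fin mulKf ?gt_eqF.
- by rewrite invr_ge0 ltW.
- by move=> x; rewrite mulr_ge0// ltW.
Qed.

Lemma sqnormZ (c : C) (f : V -> C) : sqnorm (c *: f) = ((normc c ^+ 2)%:E * sqnorm f)%E.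
Proof.
rewrite /sqnorm -esumZ ?sqr_ge0//.
  apply: eq_esum => x _; congr EFin.
  by rewrite [(c *: f) x]/(c * f x) normcM exprMn mulrCA.
by move=> x; rewrite -lee_fin sqterm_ge0.
Qed.

Lemma normc_ge0 (z : C) : 0 <= normc z.
Proof. by case: z => u v; rewrite sqrtr_ge0. Qed.

(* Weighted form of |u + v|^2 <= (s + t) (|u|^2 / s + |v|^2 / t). *)
Lemma sqnormD_le (s t : R) (f g : V -> C) : 0 < s -> 0 < t ->
  (sqnorm (f + g)%R <= ((s + t) / s)%:E * sqnorm f
                     + ((s + t) / t)%:E * sqnorm g)%E.
Proof.
move=> s0 t0; have st0 : 0 < s + t by rewrite addr_gt0.
have p0 (h : V -> C) x : 0 <= m x * normc (h x) ^+ 2.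
  by rewrite -lee_fin sqterm_ge0.
have cs : 0 <= (s + t) / s by rewrite divr_ge0// ltW.
have ct : 0 <= (s + t) / t by rewrite divr_ge0// ltW.
rewrite /sqnorm -!esumZ// -?esumD; last 2 first.
- by move=> x _; rewrite lee_fin mulr_ge0.
- by move=> x _; rewrite lee_fin mulr_ge0.
apply: le_esum => x _; rewrite -EFinD lee_fin.
rewrite !(mulrCA _ (m x)) -mulrDr.
apply: ler_wpM2l; first by rewrite ltW// vweight_gt0.
rewrite [(f + g) x]/(f x + g x).
set u := normc (f x); set v := normc (g x).
apply: (@le_trans _ _ ((u + v) ^+ 2)).
  by rewrite ler_sqr ?nnegrE ?addr_ge0 ?normc_ge0// le_normcD.
rewrite -subr_ge0.
have -> : (s + t) / s * u ^+ 2 + (s + t) / t * v ^+ 2 - (u + v) ^+ 2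
    = (s * t)^-1 * (t * u - s * v) ^+ 2.
  by field; rewrite !gt_eqF.
by rewrite mulr_ge0 ?sqr_ge0// invr_ge0 mulr_ge0 ?ltW.
Qed.

Lemma sqnorm0 : sqnorm 0 = 0%E.
Proof.
by rewrite /sqnorm esum1// => x _; rewrite [(0 : V -> C) x]/(0 : C) normc0 expr0n mulr0.
Qed.

Lemma l2pred_submod_closed : submod_closed l2pred.
Proof.
split; first by apply: mem_set; rewrite /= sqnorm0.
move=> c f g /set_mem/= f2 /set_mem/= g2; apply: mem_set => /=.
apply: le_lt_trans (sqnormD_le _ _ ltr01 ltr01) _.
rewrite lte_add_pinfty// lte_mul_pinfty ?lee_fin ?divr_ge0//.
by rewrite sqnormZ lte_mul_pinfty ?lee_fin ?sqr_ge0.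
Qed.

HB.instance Definition _ :=
  GRing.isSubmodClosed.Build C (V -> C) l2pred l2pred_submod_closed.

End l2_predicate.

Section l2_space.
Context (R : realType) (V : countType) (b : wdigraph R V).
Local Notation C := R[i].
Local Notation m := (vweight b).

Record l2 := L2 { l2fun :> V -> C ; l2P : l2fun \in l2pred b }.

HB.instance Definition _ := [isSub for l2fun].
HB.instance Definition _ := [Choice of l2 by <:].
HB.instance Definition _ := [SubChoice_isSubLmodule of l2 by <:].

Implicit Types f g : l2.

Definition l2norm f : R := Num.sqrt (fine (sqnorm b f)).

Lemma sqnorm_l2 f : sqnorm b f = (l2norm f ^+ 2)%:E.
Proof.
have fin : sqnorm b f \is a fin_num.
  by rewrite ge0_fin_numE ?sqnorm_ge0//; have /set_mem := l2P f.
by rewrite /l2norm sqr_sqrtr ?fineK ?fine_ge0 ?sqnorm_ge0.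
Qed.

Lemma l2norm_ge0 f : 0 <= l2norm f. Proof. exact: sqrtr_ge0. Qed.

Lemma l2norm_eq0 f : l2norm f = 0 -> f = 0.
Proof.
move=> f0; apply: val_inj; apply/funext => x /=.
have : (m x * normc (f x) ^+ 2)%:E = 0%E.
  apply/eqP; rewrite eq_le sqterm_ge0 andbT.
  have -> : 0%E = sqnorm b f by rewrite sqnorm_l2 f0 expr0n.
  apply: ereal_sup_ubound; exists [set x]; first by split.
  by rewrite fsbig_set1.
case=> /eqP; rewrite mulf_eq0 gt_eqF ?vweight_gt0//= expf_eq0/=.
by move=> /eqP/eq0_normc.
Qed.

Lemma l2normZ (c : C) f : l2norm (c *: f) = normc c * l2norm f.
Proof.
apply/eqP; rewrite -(@eqrXn2 _ 2)// ?mulr_ge0 ?l2norm_ge0 ?normc_ge0//.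
apply/eqP/EFin_inj; rewrite -sqnorm_l2 exprMn EFinM -sqnorm_l2.
exact: sqnormZ.
Qed.

Lemma l2normD f g : l2norm (f + g) <= l2norm f + l2norm g.
Proof.
have [/l2norm_eq0->|f0] := eqVneq (l2norm f) 0.
  by rewrite add0r lerDr l2norm_ge0.
have [/l2norm_eq0->|g0] := eqVneq (l2norm g) 0.
  by rewrite addr0 lerDl l2norm_ge0.
have {}f0 : 0 < l2norm f by rewrite lt_def f0 l2norm_ge0.
have {}g0 : 0 < l2norm g by rewrite lt_def g0 l2norm_ge0.
rewrite -ler_sqr ?nnegrE ?addr_ge0 ?l2norm_ge0//.
rewrite -lee_fin -sqnorm_l2.
have := @sqnormD_le R V b _ _ f g f0 g0.
rewrite -[(l2fun f + l2fun g)%R]/(l2fun (f + g)) => /le_trans; apply.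
rewrite !sqnorm_l2 -!EFinM -EFinD lee_fin le_eqVlt; apply/orP; left; apply/eqP.
by field; rewrite !gt_eqF.
Qed.

Fact l2_ler_normD f g : (l2norm (f + g))%:C <= (l2norm f)%:C + (l2norm g)%:C.
Proof. by rewrite -rmorphD lecR l2normD. Qed.

Fact l2_normrZ (c : C) f : (l2norm (c *: f))%:C = `|c| * (l2norm f)%:C.
Proof. by rewrite l2normZ rmorphM. Qed.

Fact l2_normr0_eq0 f : (l2norm f)%:C = 0 -> f = 0.
Proof. by move=> /eqP; rewrite (inj_eq (@complexI R)) => /eqP/l2norm_eq0. Qed.

(* Topology of the Hilbert space. The norm of the library takes values in the
   field of scalars: `|f| is (l2norm f)%:C. *)
HB.instance Definition _ :=
  Lmodule_isNormed.Build C l2 l2_ler_normD l2_normrZ l2_normr0_eq0.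

(* Sum of an absolutely summable family. *)
Definition rsum (F : V -> R) : R :=
  fine (\esum_(x in [set: V]) ((EFin \o F)^\+ x)
        - \esum_(x in [set: V]) ((EFin \o F)^\- x))%E.

Definition csum (F : V -> C) : C :=
  (rsum (fun x => complex.Re (F x)) +i* rsum (fun x => complex.Im (F x)))%C.

Definition inner f g : C := csum (fun x => (m x)%:C * f x * (g x)^*%C).

Lemma inner_norm f :
  inner f f = (l2norm f ^+ 2)%:C.
Proof.
rewrite /inner /csum.
have h x : (m x)%:C * f x * (f x)^*%C = (m x * normc (f x) ^+ 2)%:C.
  rewrite -mulrA -sqr_normc rmorphM rmorphXn//.
have -> : (fun x => complex.Re ((m x)%:C * f x * (f x)^*%C)) = fun x => m x * normc (f x) ^+ 2.
  by apply/funext => x; rewrite h.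
have -> : (fun x => complex.Im ((m x)%:C * f x * (f x)^*%C)) = fun x => 0.
  by apply/funext => x; rewrite h.
congr (_ +i* _)%C.
  rewrite /rsum.
  rewrite (eq_esum (b := fun x => (m x * normc (f x) ^+ 2)%:E)); last first.
    by move=> x _; rewrite /= (ge0_funeposE (D := setT)) ?in_setT// => y _; exact: sqterm_ge0.
  rewrite [X in (_ - X)%E]esum1 ?sube0; last first.
    by move=> x _; rewrite /= (ge0_funenegE (D := setT)) ?in_setT// => y _; exact: sqterm_ge0.
  by have := sqnorm_l2 f; rewrite /sqnorm => ->.
rewrite /rsum !esum1 ?sube0// => x _.
  by rewrite (ge0_funenegE (D := setT)) ?in_setT.
by rewrite (ge0_funeposE (D := setT)) ?in_setT.
Qed.

End l2_space.

(* Unbounded operators on the Hilbert space, given by their graphs. *)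
Section operators.
Context (R : realType) (V : countType) (b : wdigraph R V).
Local Notation C := R[i].
Local Notation E := (l2 b).

Implicit Types A B H : set (E * E).

Definition linear_operator A :=
  [/\ A 0, forall (c : C) p q, A p -> A q -> A (c *: p + q) &
      forall f g h, A (f, g) -> A (f, h) -> g = h].

Definition op_dom A : set E := [set f | exists g, A (f, g)].

Definition op_add_scalar A (z : C) : set (E * E) :=
  [set (p.1, p.2 + z *: p.1) | p in A].

Definition op_inv A : set (E * E) := [set (p.2, p.1) | p in A].

Definition op_bijective A := forall g, exists! f, A (f, g).

Definition opnorm A : \bar R :=
  ereal_sup [set (l2norm p.2)%:E | p in [set p | A p /\ l2norm p.1 <= 1]].

Definition op_bounded A := (opnorm A < +oo)%E.

Definition resolvent_set A : set C :=
  [set z | op_bijective (op_add_scalar A (- z)) /\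
           op_bounded (op_inv (op_add_scalar A (- z)))].

Definition adjoint A : set (E * E) :=
  [set p | forall q, A q -> inner q.2 p.1 = inner q.1 p.2].

Definition self_adjoint A :=
  [/\ linear_operator A, dense (op_dom A) & A = adjoint A].

Definition essentially_self_adjoint A := self_adjoint (closure A).

Definition accretive A :=
  linear_operator A /\
  forall f g, A (f, g) -> 0 <= complex.Re (inner g f).

Definition m_accretive A :=
  [/\ accretive A,
      [set z | complex.Re z < 0] `<=` resolvent_set A &
      forall lambda : C, 0 < complex.Re lambda ->
        (opnorm (op_inv (op_add_scalar A lambda))
           <= (1 / complex.Re lambda)%:E)%E].

(* B is relatively bounded with respect to H, with constant smaller than r;
   used for B and H having the same domain. *)
Definition relatively_bounded_lt B H (r : R) :=
  exists c a : R, [/\ 0 < c, 0 < a, a < r &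
    forall f g h, B (f, g) -> H (f, h) ->
      l2norm g <= c * l2norm f + a * l2norm h].

End operators.

Section laplacian.
Context (R : realType) (V : countType) (b : wdigraph R V).
Local Notation C := R[i].
Local Notation m := (vweight b).

Definition fin_supp (f : V -> C) := finite_set [set x | f x != 0].

Definition lap (f : V -> C) : V -> C := fun x =>
  ((m x)^-1)%:C * \sum_(y \in [set: V]) (b x y)%:C * (f x - f y).

Definition lap' (f : V -> C) : V -> C := fun x =>
  ((m x)^-1)%:C * \sum_(y \in [set: V]) (b y x)%:C * (f x - f y).

Definition sym_part (f : V -> C) : V -> C := 2^-1 *: (lap f + lap' f).

Definition skew_part (f : V -> C) : V -> C := 2^-1 *: (lap f - lap' f).

(* Graph of T with domain the finitely supported functions; T is meant to send
   these to square-summable functions, see op_dom_Cc and fin_supp_lap below. *)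
Definition op_on_Cc (T : (V -> C) -> (V -> C)) : set (l2 b * l2 b) :=
  [set p : l2 b * l2 b | fin_supp p.1 /\ p.2 = T p.1 :> (V -> C)].

Lemma fin_supp_l2 f : fin_supp f -> f \in l2pred b.
Proof.
move=> finf; apply: mem_set => /=.
have -> : sqnorm b f = \esum_(x in [set x | f x != 0])
    (m x * normc (f x) ^+ 2)%:E.
  rewrite /sqnorm [RHS]esum_mkcond; apply: eq_esum => x _.
  case: ifPn => //; rewrite notin_setE/= => /negP; rewrite negbK => /eqP ->.
  by rewrite normc0 expr0n mulr0.
rewrite esum_fset//; last by move=> x _; exact: sqterm_ge0.
by rewrite fsumEFin// ltry.
Qed.

Lemma op_dom_Cc T : (forall f, fin_supp f -> fin_supp (T f)) ->
  op_dom (op_on_Cc T) = [set f : l2 b | fin_supp f].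
Proof.
move=> finT; apply/seteqP; split=> [f [g []]//|f /= finf].
by exists (L2 (fin_supp_l2 (finT _ finf))).
Qed.

Lemma fin_supp_nbr f : locally_finite b -> fin_supp f ->
  finite_set [set x | f x != 0 \/ exists2 y, f y != 0 & adjacent b y x].
Proof.
move=> lf finf; rewrite [X in finite_set X](_ : _ = [set x | f x != 0] `|`
   \bigcup_(y in [set y | f y != 0]) [set x | adjacent b y x]).
  by rewrite finite_setU; split=> //; apply: bigcup_finite.
apply/seteqP; split=> x [fx|]; first by left.
- by move=> [y fy yx]; right; exists y.
- by left.
- by move=> [y fy yx]; right; exists y.
Qed.

Lemma fin_supp_lap f : locally_finite b -> fin_supp f ->
  [/\ fin_supp (lap f), fin_supp (lap' f), fin_supp (sym_part f)
    & fin_supp (skew_part f)].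
Proof.
move=> lf finf.
suff H x : ~ (f x != 0 \/ exists2 y, f y != 0 & adjacent b y x) ->
    lap f x = 0 /\ lap' f x = 0.
  split; apply: sub_finite_set (fin_supp_nbr lf finf) => x /=;
    apply: contra_neqP => /H[lx l'x] //.
  - transitivity (2^-1 * (lap f x + lap' f x) : C) => //.
    by rewrite lx l'x addr0 mulr0.
  - transitivity (2^-1 * (lap f x - lap' f x) : C) => //.
    by rewrite lx l'x subr0 mulr0.
move=> nx.
have fx : f x = 0 by apply/eqP; apply/negP => fx; apply: nx; left; apply/negP.
have term y : f x - f y != 0 -> b x y = 0 /\ b y x = 0.
  rewrite fx sub0r oppr_eq0 => fy.
  have /negP : ~ adjacent b y x by move=> yx; apply: nx; right; exists y.
  rewrite /adjacent negb_or -!leNgt => /andP[yx xy].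
  by split; apply/eqP; rewrite eq_le ?xy ?yx edge_weight_ge0.
by split; rewrite /lap /lap' fsbig1 ?mulr0// => y _;
  have [->|/term[xy yx]] := eqVneq (f x - f y) 0; rewrite ?mulr0//;
  rewrite ?xy ?yx rmorph0 mul0r.
Qed.

End laplacian.

Arguments op_on_Cc {R V} b T.

(* Main.v *)
From HB Require Import structures.
From mathcomp Require Import all_boot all_order all_algebra.
From mathcomp Require Import finmap complex.
From mathcomp Require Import all_classical all_reals all_analysis.
From mathcomp Require Import ring lra.
Require Import Defs.

(** The operator D = H + B on finitely supported functions is accretive: by
    Kirchhoff's assumption the two halves of the sum over edges x, y of
    b(x,y) (|f(x)|^2 - |f(y)|^2) cancel, which leaves
    2 Re <D f, f> = sum of b(x,y) |f(x) - f(y)|^2 >= 0 ([lap_form_ge0]).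
    The reversed graph satisfies the same assumptions, so the formal adjoint of
    D and the average H of the two are accretive too.

    For any accretive A, testing (A + z) f against f gives
    Re z ||f|| <= ||(A + z) f||.  If A is densely defined, its closure is again
    an accretive operator ([accretive_closure]), and it is m-accretive as soon
    as A + z has dense range for every z with Re z > 0: the estimate turns
    approximate solutions of (A + z) f = g into Cauchy sequences, the space is
    complete ([l2_complete]), and the estimate also bounds the inverse
    ([m_accretive_closure]).

    Everything is thus reduced to density of ranges, for which one criterion is
    used throughout: a linear subspace K is dense as soon as every nonzero
    vector v is strictly closer to some element of K than to 0
    ([dense_of_closer]).  Indeed a minimising sequence for the distance from v
    to K converges, and its residual w is not shortened by any element of K, so
    w = 0.  As a consequence, K is dense when every element f of some dense set
    has a point of K within q ||f||, for a fixed q < 1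
    ([dense_perturbation]).  This is applied in two ways.

    - If A is accretive and the range of A + t is dense, with t > 0, then so is
      that of A + z whenever |z - t| < t.  These discs exhaust the right
      half-plane as t grows, so large real t suffice
      ([dense_shifted_range_halfplane]).

    - For t > 0 the range of H + t is dense: a vector u orthogonal to it lies in
      the domain of the adjoint, hence of the closure of H, which maps u to
      -t u; since the closure of H is nonnegative, u = 0
      ([dense_shifted_range_esa]).  Moreover ||f|| <= ||(H + t) f|| / t and
      ||H f|| <= 2 ||(H + t) f||, so that
      ||B f|| <= (c / t + 2 a) ||(H + t) f||.  Since a < 1/2, the constant is
      below 1 for large t, and the range of D + t = (H + t) + B is dense as
      well ([dense_shifted_range_relatively_bounded]). *)

Set Implicit Arguments.
Unset Strict Implicit.
Unset Printing Implicit Defensive.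

Import Order.TTheory GRing.Theory Num.Theory.
Import numFieldNormedType.Exports.
Import Normc.

Local Open Scope classical_set_scope.
Local Open Scope ring_scope.
Local Open Scope complex_scope.

(** * Sums of absolutely summable real families *)

Section real_sums.
Context (R : realType) (V : countType).
Implicit Types F G : V -> R.

Definition rsummable F := summable [set: V] (EFin \o F).

Lemma rsummable_fin_num F : (forall x, 0 <= F x) -> rsummable F ->
  \esum_(x in [set: V]) (F x)%:E \is a fin_num.
Proof.
move=> F0; rewrite /rsummable summableE => /=.
by under eq_esum do rewrite ger0_norm//.
Qed.

Lemma le_rsummable F G : (forall x, `|F x| <= G x) -> rsummable G ->
  rsummable F.
Proof.
move=> FG; apply: le_lt_trans; apply: le_esum => x _ /=.
by rewrite lee_fin (le_trans (FG x))// ler_norm.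
Qed.

(** Any splitting into nonnegative summable families computes the sum, not just
    the one into positive and negative parts that defines it. *)
Lemma rsumB F G : (forall x, 0 <= F x) -> (forall x, 0 <= G x) ->
  rsummable F -> rsummable G ->
  rsum (fun x => F x - G x) =
    fine (\esum_(x in [set: V]) (F x)%:E) - fine (\esum_(x in [set: V]) (G x)%:E).
Proof.
move=> F0 G0 sF sG; rewrite /rsum.
have -> : EFin \o (fun x => F x - G x) = ((EFin \o F) \- (EFin \o G))%E :> (V -> \bar R).
  by apply/funext => x.
by rewrite esumB// -?fineB// ?rsummable_fin_num// => x _; rewrite lee_fin.
Qed.

Let pos_part_ge0 F x : 0 <= F x + `|F x|.
Proof. by have := ler_norm (- F x); rewrite normrN; lra. Qed.

Let rsummable_norm F : rsummable F -> rsummable (fun x => `|F x|).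
Proof.
rewrite /rsummable /summable; congr (_ < _)%E; apply: eq_esum => x _ /=.
by rewrite normr_id.
Qed.

Lemma rsummableD F G : rsummable F -> rsummable G ->
  rsummable (fun x => F x + G x).
Proof. by move=> sF sG; have := summableD sF sG; congr summable. Qed.

Lemma rsummableZ (c : R) F : rsummable F -> rsummable (fun x => c * F x).
Proof.
move=> sF; rewrite /rsummable /summable.
rewrite (eq_esum (b := fun x => (`|c| * `|F x|)%:E)); last first.
  by move=> x _ /=; rewrite normrM.
by rewrite esumZ// lte_mul_pinfty ?lee_fin.
Qed.

(** With F = (F + |F|) - |F|, additivity reduces to that of sums of nonnegative
    families. *)
Lemma rsumD F G : rsummable F -> rsummable G ->
  rsum (fun x => F x + G x) = rsum F + rsum G.
Proof.
move=> sF sG; have nF := rsummable_norm sF; have nG := rsummable_norm sG.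
have split_rsum (H : V -> R) : rsummable H -> rsum H =
    fine (\esum_(x in [set: V]) (H x + `|H x|)%:E)
    - fine (\esum_(x in [set: V]) (`|H x|)%:E).
  move=> sH; have nH := rsummable_norm sH.
  rewrite -rsumB//; last exact: rsummableD.
  by congr rsum; apply/funext => x; rewrite addrK.
have esum_add (e e' : V -> R) : (forall x, 0 <= e x) -> (forall x, 0 <= e' x) ->
    rsummable e -> rsummable e' ->
    fine (\esum_(x in [set: V]) (e x + e' x)%:E) =
    fine (\esum_(x in [set: V]) (e x)%:E) +
    fine (\esum_(x in [set: V]) (e' x)%:E).
  move=> e0 e'0 se se'; under eq_esum do rewrite EFinD.
  rewrite esumD; try by move=> x _; rewrite lee_fin.
  by rewrite fineD ?rsummable_fin_num.
have -> : (fun x => F x + G x) =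
    (fun x => ((F x + `|F x|) + (G x + `|G x|)) - (`|F x| + `|G x|)).
  by apply/funext => x; ring.
rewrite rsumB; last first.
- exact: rsummableD.
- by apply: rsummableD; exact: rsummableD.
- by move=> x; rewrite addr_ge0.
- by move=> x; rewrite addr_ge0.
rewrite (esum_add (fun x => F x + `|F x|) (fun x => G x + `|G x|))//;
  try exact: rsummableD.
rewrite (esum_add (fun x => `|F x|) (fun x => `|G x|))// !split_rsum//.
by rewrite opprD addrACA.
Qed.

Lemma rsumZ (c : R) F : rsummable F -> rsum (fun x => c * F x) = c * rsum F.
Proof.
move=> sF; have nF := rsummable_norm sF.
have sp : rsummable (fun x => F x + `|F x|) by exact: rsummableD.
have -> : rsum F = fine (\esum_(x in [set: V]) (F x + `|F x|)%:E)
    - fine (\esum_(x in [set: V]) (`|F x|)%:E).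
  by rewrite -rsumB//; congr rsum; apply/funext => x; rewrite addrK.
have esum_scale (e : V -> R) : (forall x, 0 <= e x) -> rsummable e ->
    fine (\esum_(x in [set: V]) (`|c| * e x)%:E) =
    `|c| * fine (\esum_(x in [set: V]) (e x)%:E).
  by move=> e0 se; rewrite esumZ// fineM// rsummable_fin_num.
have [c0|c0] := leP 0 c.
  have -> : (fun x => c * F x) =
      (fun x => `|c| * (F x + `|F x|) - `|c| * `|F x|).
    by apply/funext => x; rewrite ger0_norm//; ring.
  rewrite rsumB//; try exact: rsummableZ; try by move=> x; rewrite mulr_ge0.
  by rewrite (esum_scale (fun x => F x + `|F x|))// (esum_scale (fun x => `|F x|))// ger0_norm//; ring.
have -> : (fun x => c * F x) =
    (fun x => `|c| * `|F x| - `|c| * (F x + `|F x|)).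
  by apply/funext => x; rewrite ltr0_norm//; ring.
rewrite rsumB//; try exact: rsummableZ; try by move=> x; rewrite mulr_ge0.
by rewrite (esum_scale (fun x => F x + `|F x|))// (esum_scale (fun x => `|F x|))// ltr0_norm//; ring.
Qed.

Lemma rsum_fin (S : set V) F : finite_set S -> (forall x, ~ S x -> F x = 0) ->
  rsum F = \sum_(x \in S) F x.
Proof.
move=> finS F0.
have h (e : V -> R) : (forall x, 0 <= e x) -> (forall x, ~ S x -> e x = 0) ->
    \esum_(x in [set: V]) (e x)%:E = (\sum_(x \in S) e x)%:E.
  move=> e0 eS; rewrite -fsumEFin// -esum_fset//; last first.
    by move=> x _; rewrite lee_fin.
  rewrite [RHS]esum_mkcond; apply: eq_esum => x _; case: ifPn => //.
  by rewrite notin_setE => /eS ->.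
have sum (e : V -> R) : (forall x, 0 <= e x) -> (forall x, ~ S x -> e x = 0) ->
    rsummable e.
  move=> e0 eS; rewrite /rsummable /summable /=.
  by under eq_esum do rewrite ger0_norm//; rewrite h// ltry.
rewrite (_ : F = fun x => (F x + `|F x|) - `|F x|); last first.
  by apply/funext => x; rewrite addrK.
have pS x : ~ S x -> F x + `|F x| = 0 by move=> /F0 ->; rewrite normr0 addr0.
have nS x : ~ S x -> `|F x| = 0 by move=> /F0 ->; rewrite normr0.
rewrite rsumB//; try exact: sum.
rewrite !h//= !fsbig_finite//= -sumrB.
by [].
Qed.

End real_sums.

(** * The inner product of the weighted space *)

Section inner_product.
Context (R : realType) (V : countType) (b : wdigraph R V).
Local Notation C := R[i].
Local Notation m := (vweight b).
Implicit Types f g h : l2 b.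

(** Distances and accretivity involve the real part only, which is a symmetric
    real bilinear form. *)
Definition rinner f g : R := complex.Re (inner f g).

Let inner_term f g x : C := (m x)%:C * f x * (g x)^*%C.

Lemma sqnorm_rsummable f : rsummable (fun x => m x * normc (f x) ^+ 2).
Proof.
rewrite /rsummable /summable /=.
under eq_esum do rewrite ger0_norm -?lee_fin ?sqterm_ge0//.
by have /set_mem := l2P f.
Qed.

Lemma norm_Re_le_normc (z : C) : `|complex.Re z| <= normc z.
Proof. by case: z => x y /=; rewrite -sqrtr_sqr ler_wsqrtr// lerDl sqr_ge0. Qed.

Lemma norm_Im_le_normc (z : C) : `|complex.Im z| <= normc z.
Proof. by case: z => x y /=; rewrite -sqrtr_sqr ler_wsqrtr// lerDr sqr_ge0. Qed.

Lemma normc_conj (z : C) : normc z^*%C = normc z.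
Proof. by case: z => x y /=; rewrite sqrrN. Qed.

Lemma normc_real (x : R) : normc x%:C = `|x|.
Proof. by rewrite /= expr0n addr0 sqrtr_sqr. Qed.

Lemma normc_inner_term f g x :
  normc (inner_term f g x) <= m x * normc (f x) ^+ 2 + m x * normc (g x) ^+ 2.
Proof.
have m0 := ltW (vweight_gt0 b x).
rewrite /inner_term !normcM normc_conj normc_real ger0_norm//.
rewrite -mulrA -mulrDr ler_wpM2l//.
set u := normc (f x); set v := normc (g x).
have := sqr_ge0 (u - v); have := sqr_ge0 u; have := sqr_ge0 v; nra.
Qed.

Let summable_Re f g : rsummable (fun x => complex.Re (inner_term f g x)).
Proof.
have := rsummableD (sqnorm_rsummable f) (sqnorm_rsummable g).
apply: le_rsummable => x.
exact: le_trans (norm_Re_le_normc _) (normc_inner_term _ _ _).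
Qed.

Let summable_Im f g : rsummable (fun x => complex.Im (inner_term f g x)).
Proof.
have := rsummableD (sqnorm_rsummable f) (sqnorm_rsummable g).
apply: le_rsummable => x.
exact: le_trans (norm_Im_le_normc _) (normc_inner_term _ _ _).
Qed.

Lemma complexReD (z w : C) : complex.Re (z + w) = complex.Re z + complex.Re w.
Proof. by case: z; case: w. Qed.
Lemma complexImD (z w : C) : complex.Im (z + w) = complex.Im z + complex.Im w.
Proof. by case: z; case: w. Qed.
Lemma complexReM (z w : C) : complex.Re (z * w) =
  complex.Re z * complex.Re w - complex.Im z * complex.Im w.
Proof. by case: z; case: w. Qed.
Lemma complexImM (z w : C) : complex.Im (z * w) =
  complex.Re z * complex.Im w + complex.Im z * complex.Re w.
Proof. by case: z => a c; case: w => d e /=; rewrite addrC. Qed.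

Lemma Re_conjM (z : C) : complex.Re (z^*%C * z) = normc z ^+ 2.
Proof. by rewrite mulrC -sqr_normc -rmorphXn. Qed.

Lemma innerDl f g h : inner (f + g) h = inner f h + inner g h.
Proof.
rewrite /inner /csum.
have E x : (m x)%:C * (f + g) x * (h x)^*%C = inner_term f h x + inner_term g h x.
  by rewrite /inner_term -mulrDl -mulrDr.
have -> : rsum (fun x => complex.Re ((m x)%:C * (f + g) x * (h x)^*%C)) =
    rsum (fun x => complex.Re (inner_term f h x) + complex.Re (inner_term g h x)).
  by congr rsum; apply/funext => x; rewrite E complexReD.
have -> : rsum (fun x => complex.Im ((m x)%:C * (f + g) x * (h x)^*%C)) =
    rsum (fun x => complex.Im (inner_term f h x) + complex.Im (inner_term g h x)).
  by congr rsum; apply/funext => x; rewrite E complexImD.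
by rewrite !rsumD.
Qed.

Lemma innerZl (c : C) f g : inner (c *: f) g = c * inner f g.
Proof.
rewrite /inner /csum.
have E x : (m x)%:C * (c *: f) x * (g x)^*%C = c * inner_term f g x.
  by rewrite /inner_term [(c *: f) x]/(c * f x) !mulrA [c * _]mulrC.
have -> : rsum (fun x => complex.Re ((m x)%:C * (c *: f) x * (g x)^*%C)) =
    rsum (fun x => complex.Re c * complex.Re (inner_term f g x)
      + (- complex.Im c) * complex.Im (inner_term f g x)).
  by congr rsum; apply/funext => x; rewrite E complexReM mulNr.
have -> : rsum (fun x => complex.Im ((m x)%:C * (c *: f) x * (g x)^*%C)) =
    rsum (fun x => complex.Re c * complex.Im (inner_term f g x)
      + complex.Im c * complex.Re (inner_term f g x)).
  by congr rsum; apply/funext => x; rewrite E complexImM.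
rewrite !rsumD; try exact: rsummableZ.
rewrite !rsumZ//.
by apply/eqP; rewrite eq_complex complexReM complexImM/= mulNr !eqxx.
Qed.

Lemma inner_conj f g : inner g f = (inner f g)^*%C.
Proof.
rewrite /inner /csum.
have E x : (m x)%:C * g x * (f x)^*%C = (inner_term f g x)^*%C.
  by rewrite /inner_term !rmorphM/= conjcK oppr0 mulrAC.
have -> : rsum (fun x => complex.Im ((m x)%:C * g x * (f x)^*%C)) =
    rsum (fun x => (-1) * complex.Im (inner_term f g x)).
  by congr rsum; apply/funext => x; rewrite E mulN1r; case: inner_term.
have -> : rsum (fun x => complex.Re ((m x)%:C * g x * (f x)^*%C)) =
    rsum (fun x => complex.Re (inner_term f g x)).
  by congr rsum; apply/funext => x; rewrite E; case: inner_term.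
by rewrite rsumZ// mulN1r.
Qed.

Lemma innerDr f g h : inner f (g + h) = inner f g + inner f h.
Proof. by rewrite (inner_conj (g + h)) innerDl rmorphD (inner_conj g f) (inner_conj h f). Qed.

Lemma innerZr (c : C) f g : inner f (c *: g) = c^*%C * inner f g.
Proof. by rewrite (inner_conj (c *: g)) innerZl rmorphM (inner_conj g f). Qed.

Lemma innerBl f g h : inner (f - g) h = inner f h - inner g h.
Proof. by rewrite innerDl -scaleN1r innerZl mulN1r. Qed.

Lemma rinnerDl f g h : rinner (f + g) h = rinner f h + rinner g h.
Proof. by rewrite /rinner innerDl complexReD. Qed.

Lemma rinnerDr f g h : rinner f (g + h) = rinner f g + rinner f h.
Proof. by rewrite /rinner innerDr complexReD. Qed.

Lemma rinnerC f g : rinner f g = rinner g f.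
Proof. by rewrite /rinner inner_conj; case: inner. Qed.

Lemma rinnerZl (t : R) f g : rinner (t%:C *: f) g = t * rinner f g.
Proof. by rewrite /rinner innerZl complexReM /= mul0r subr0. Qed.

Lemma rinnerZr (t : R) f g : rinner f (t%:C *: g) = t * rinner f g.
Proof. by rewrite rinnerC rinnerZl rinnerC. Qed.

Lemma rinnerBl f g h : rinner (f - g) h = rinner f h - rinner g h.
Proof. by rewrite rinnerDl -[- g]scaleN1r -(rmorphN1 (real_complex R)) rinnerZl mulN1r. Qed.

Lemma rinnerBr f g h : rinner f (g - h) = rinner f g - rinner f h.
Proof. by rewrite rinnerC rinnerBl !(rinnerC _ f). Qed.

Lemma rinner_norm f : rinner f f = l2norm f ^+ 2.
Proof. by rewrite /rinner inner_norm. Qed.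

Lemma l2norm_sqrD f g :
  l2norm (f + g) ^+ 2 = l2norm f ^+ 2 + 2 * rinner f g + l2norm g ^+ 2.
Proof.
rewrite -!rinner_norm rinnerDl !rinnerDr (rinnerC g f); ring.
Qed.

Lemma l2normN f : l2norm (- f) = l2norm f.
Proof. by rewrite -scaleN1r l2normZ normcN normc1 mul1r. Qed.

Lemma l2normB f g : l2norm (f - g) = l2norm (g - f).
Proof. by rewrite -l2normN opprB. Qed.

Lemma l2norm0 : l2norm (0 : l2 b) = 0.
Proof. by rewrite -(scale0r (0 : l2 b)) l2normZ normc0 mul0r. Qed.

Lemma l2norm_triangle h f g : l2norm (f - g) <= l2norm (f - h) + l2norm (h - g).
Proof. by rewrite -[f - g](subrKA h) l2normD. Qed.

Lemma l2normZr (t : R) f : l2norm (t%:C *: f) = `|t| * l2norm f.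
Proof. by rewrite l2normZ normc_real. Qed.

(** Cauchy-Schwarz for the real part: it is the triangle inequality, squared and
    expanded. *)
Lemma rinner_le f g : rinner f g <= l2norm f * l2norm g.
Proof.
have := l2normD f g; rewrite -ler_sqr ?nnegrE ?addr_ge0 ?l2norm_ge0//.
rewrite l2norm_sqrD sqrrD; nra.
Qed.

(** The real version applied to f rotated by the phase of the inner product. *)
Lemma normc_inner_le f g : normc (inner f g) <= l2norm f * l2norm g.
Proof.
set z := inner f g.
have [->|z0] := eqVneq (normc z) 0; first by rewrite mulr_ge0 ?l2norm_ge0.
have {}z0 : 0 < normc z by rewrite lt_def z0 normc_ge0.
have := rinner_le (z^*%C *: f) g.
rewrite /rinner innerZl -/z l2normZ normc_conj.
by rewrite Re_conjM expr2 -mulrA ler_pM2l.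
Qed.

End inner_product.

(** * Completeness *)

Section completeness.
Context (R : realType) (V : countType) (b : wdigraph R V).
Local Notation C := R[i].
Local Notation m := (vweight b).
Implicit Types f g h : l2 b.

Lemma real_cauchy_cvg (a : nat -> R) :
  (forall e, 0 < e -> exists N, forall n k, (N <= n)%N -> (N <= k)%N ->
    `|a n - a k| <= e) -> cvg (a @ \oo).
Proof.
move=> cau; apply: cauchy_cvg; apply: cauchy_exP => e e0.
have [N aN] := cau _ (divr_gt0 e0 (ltr0Sn R 1)).
exists (a N); rewrite /fmapE -ball_normE; exists N => // k /= Nk.
by apply: le_lt_trans (aN _ _ (leqnn N) Nk) _; lra.
Qed.

Lemma fsum_sqnorm_le (A : set V) f : finite_set A ->
  \sum_(x \in A) (m x * normc (f x) ^+ 2) <= l2norm f ^+ 2.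
Proof.
move=> finA; rewrite -lee_fin -sqnorm_l2 -fsumEFin//.
by apply: ereal_sup_ubound; exists A.
Qed.

Lemma normc_sqr (z : C) : normc z ^+ 2 = complex.Re z ^+ 2 + complex.Im z ^+ 2.
Proof. by case: z => x y /=; rewrite sqr_sqrtr// addr_ge0 ?sqr_ge0. Qed.

Lemma normc_eval_le f x : normc (f x) <= (Num.sqrt (m x))^-1 * l2norm f.
Proof.
have m0 := vweight_gt0 b x; have m0' := ltW m0.
have := ler_wsqrtr (fsum_sqnorm_le f (finite_set1 x)).
rewrite fsbig_set1 sqrtrM// !sqrtr_sqr !ger0_norm ?l2norm_ge0 ?normc_ge0// => le.
by rewrite mulrC ler_pdivlMr ?sqrtr_gt0// mulrC.
Qed.

(** Evaluation at a vertex is continuous, so a Cauchy sequence converges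
    pointwise; the bound on its tail holds on every finite set of vertices,
    passes to the pointwise limit there, and then to the supremum over all
    finite sets. *)
Lemma l2_complete (u : nat -> l2 b) :
  (forall e, 0 < e -> exists N, forall n k, (N <= n)%N -> (N <= k)%N ->
    l2norm (u n - u k) <= e) ->
  exists l, forall e, 0 < e -> exists N, forall n, (N <= n)%N ->
    l2norm (u n - l) <= e.
Proof.
move=> cau.
have cau_x x e : 0 < e -> exists N, forall n k, (N <= n)%N -> (N <= k)%N ->
    normc (u n x - u k x) <= e.
  move=> e0; have s0 : 0 < Num.sqrt (m x) by rewrite sqrtr_gt0 vweight_gt0.
  have [N uN] := cau (Num.sqrt (m x) * e) (mulr_gt0 s0 e0).
  exists N => n k Nn Nk.
  apply: le_trans (normc_eval_le (u n - u k) x) _.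
  by rewrite mulrC ler_pdivrMr// mulrC; exact: uN.
pose Lr x := lim ((fun n => complex.Re (u n x)) @ \oo).
pose Li x := lim ((fun n => complex.Im (u n x)) @ \oo).
have cRe x : (fun n => complex.Re (u n x)) @ \oo --> Lr x.
  apply: real_cauchy_cvg => e /(cau_x x)[N uN]; exists N => n k Nn Nk.
  apply: le_trans (uN _ _ Nn Nk); apply: le_trans (norm_Re_le_normc _).
  by rewrite le_eqVlt; case: (u n x) (u k x) => [? ?] [? ?] /=; rewrite eqxx.
have cIm x : (fun n => complex.Im (u n x)) @ \oo --> Li x.
  apply: real_cauchy_cvg => e /(cau_x x)[N uN]; exists N => n k Nn Nk.
  apply: le_trans (uN _ _ Nn Nk); apply: le_trans (norm_Im_le_normc _).
  by rewrite le_eqVlt; case: (u n x) (u k x) => [? ?] [? ?] /=; rewrite eqxx.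
pose L x : C := (Lr x +i* Li x)%C.
have close e : 0 < e -> exists N, forall n, (N <= n)%N ->
    (sqnorm b (fun x => (u n x - L x)%R) <= (e ^+ 2)%:E)%E.
  move=> e0; have [N uN] := cau e e0; exists N => n Nn.
  apply: ge_ereal_sup => _ [A [finA _] <-].
  rewrite fsumEFin// lee_fin fsbig_finite//=.
  pose t k x := m x * ((complex.Re (u n x) - complex.Re (u k x)) ^+ 2 +
     (complex.Im (u n x) - complex.Im (u k x)) ^+ 2).
  have ct : (fun k => \sum_(x <- fset_set A) t k x) @ \oo -->
     \sum_(x <- fset_set A) (m x * normc (u n x - L x)%R ^+ 2).
    apply: cvg_big; first exact: add_continuous.
    move=> x _; rewrite normc_sqr; apply: cvgMr.
    have -> : complex.Re (u n x - L x) = complex.Re (u n x) - Lr x.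
      by case: (u n x).
    have -> : complex.Im (u n x - L x) = complex.Im (u n x) - Li x.
      by case: (u n x).
    by apply: cvgD; rewrite expr2; apply: cvgM; apply: cvgB => //; exact: cvg_cst.
  apply: (cvgr_to_le ct); exists N => // k /= Nk.
  have := @fsum_sqnorm_le A (u n - u k) finA.
  rewrite fsbig_finite//= (_ : \sum_(x <- _) _ = \sum_(x <- fset_set A) t k x).
    move=> /le_trans; apply; rewrite ler_sqr ?nnegrE ?l2norm_ge0 ?(ltW e0)//.
    exact: uN.
  apply: eq_bigr => x _; rewrite [LHS]/(m x * normc (u n x - u k x)%R ^+ 2).
  rewrite normc_sqr /t.
  by case: (u n x) (u k x) => [? ?] [? ?].
have [N uN] := close 1 ltr01.
have dP : (fun x => u N x - L x) \in l2pred b.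
  by apply: mem_set; exact: le_lt_trans (uN N (leqnn _)) (ltry _).
exists (u N - L2 dP) => e e0; have [M uM] := close e e0; exists M => n Mn.
rewrite -ler_sqr ?nnegrE ?l2norm_ge0 ?(ltW e0)//.
rewrite -lee_fin -sqnorm_l2; apply: le_trans (uM n Mn).
rewrite le_eqVlt; apply/orP; left; apply/eqP; congr sqnorm; apply/funext => x.
transitivity (u n x - (u N x - (u N x - L x))) => //.
by rewrite subKr.
Qed.

End completeness.

(** * Density of linear subspaces *)

Section density.
Context (R : realType) (V : countType) (b : wdigraph R V).
Local Notation C := R[i].
Local Notation E := (l2 b).
Implicit Types (f g h v : E) (K : set E).

Lemma complex_gt0 (z : C) : 0 < z -> exists2 e : R, 0 < e & z = e%:C.
Proof.
by case: z => x y; rewrite ltcE/= => /andP[/eqP -> x0]; exists x.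
Qed.

Lemma ball_l2E f (e : R) g : ball f (e%:C : C) g = (l2norm (f - g) < e) :> Prop.
Proof. by rewrite -ball_normE /ball_ /= -ltcR. Qed.

Lemma closure_pairP (A : set (E * E)) p : closure A p <->
  forall e : R, 0 < e -> exists q,
    [/\ A q, l2norm (p.1 - q.1) < e & l2norm (p.2 - q.2) < e].
Proof.
split=> [cA e e0|cA B /nbhs_ballP[_/= /complex_gt0[e e0 ->] eB]].
  have ec0 : 0 < e%:C :> C by rewrite ltcR.
  have [q [Aq [q1 q2]]] := cA _ (nbhsx_ballx p _ ec0).
  by exists q; split => //; rewrite -ball_l2E.
have [q [Aq q1 q2]] := cA e e0; exists q; split => //; apply: eB.
by split; rewrite ball_l2E.
Qed.

Lemma dense_l2P K : dense K <->
  forall v (e : R), 0 < e -> exists2 k, K k & l2norm (v - k) < e.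
Proof.
split=> [dK v e e0|dK O [v Ov]].
  have ec0 : 0 < e%:C :> C by rewrite ltcR.
  have [|k [vk Kk]] := dK (ball v (e%:C : C)) _ (ball_open _ _).
    by exists v; exact: ballxx.
  by exists k => //; rewrite -ball_l2E.
rewrite openE => /(_ _ Ov)/nbhs_ballP[_/= /complex_gt0[e e0 ->] eO].
by have [k Kk vk] := dK v e e0; exists k; split => //; apply: eO; rewrite ball_l2E.
Qed.

Definition linear_subspace K :=
  K 0 /\ forall (c : C) f g, K f -> K g -> K (c *: f + g).

Lemma linear_subspaceZ K (c : C) f : linear_subspace K -> K f -> K (c *: f).
Proof. by move=> [K0 KZ] Kf; rewrite -[_ *: _]addr0; exact: KZ. Qed.

Lemma parallelogram f g :
  l2norm (f - g) ^+ 2 = 2 * l2norm f ^+ 2 + 2 * l2norm g ^+ 2 - l2norm (f + g) ^+ 2.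
Proof.
rewrite (l2norm_sqrD f g) (l2norm_sqrD f (- g)) l2normN.
have -> : - g = (-1 : R)%:C *: g by rewrite rmorphN1 scaleN1r.
by rewrite rinnerZr; ring.
Qed.

Lemma small_invn (e : R) : 0 < e -> exists N, forall n, (N <= n)%N ->
  n.+1%:R^-1 < e.
Proof.
move=> e0; exists (Num.bound e^-1) => n Nn.
rewrite -[ltRHS]invrK ltf_pV2 ?posrE ?invr_gt0//.
have := archi_boundP (ltW (_ : 0 < e^-1)); rewrite invr_gt0 => /(_ e0).
by move=> /lt_le_trans; apply; rewrite ler_nat leqW.
Qed.

(** The contradiction that ends the next proof.  Here A and a are the lengths of
    the limit residual and of its shortened version, B and c those of an
    approximating residual, within d of the former: they still differ by d, so
    B^2 exceeds c^2 by at least d^2, which is too much since c^2 is at least the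
    infimum I and B^2 exceeds I by less than s < d^2. *)
Lemma gap_absurd (a c A B d I s : R) : 0 <= c -> c <= d + a -> A <= d + B ->
  A - a = d * 3 -> 0 < d -> I <= c ^+ 2 -> B ^+ 2 < I + s -> s < d ^+ 2 -> False.
Proof.
move=> c0 ca AB Aa d0 Ic BI sd.
have cdB : c + d <= B by lra.
have : (c + d) ^+ 2 <= B ^+ 2 by rewrite ler_sqr ?nnegrE; lra.
have : 0 <= c * d by rewrite mulr_ge0// ltW.
by rewrite sqrrD; lra.
Qed.

(** The squared distances from v to a minimising sequence k n of K are within
    1/(n+1) of their infimum, so by the parallelogram identity the residuals
    v - k n form a Cauchy sequence.  If their limit w' were nonzero, some h in K
    would shorten it by a fixed amount, and k n + h would beat the infimum for large n. *)
Lemma dense_of_closer K : linear_subspace K ->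
  (forall v, v != 0 -> exists2 k, K k & l2norm (v - k) < l2norm v) ->
  dense K.
Proof.
move=> sK closer; have [K0 KZ] := sK.
apply/dense_l2P => v.
pose S := [set l2norm (v - k) ^+ 2 | k in K].
have infS : has_inf S.
  split; first by exists (l2norm (v - 0) ^+ 2), 0.
  by exists 0 => _ [k _ <-]; exact: sqr_ge0.
have infD k : K k -> inf S <= l2norm (v - k) ^+ 2.
  by move=> Kk; apply: ge_inf; [case: infS|exists k].
have /choice[k kP] : forall n : nat, exists k, K k /\
    l2norm (v - k) ^+ 2 < inf S + n.+1%:R^-1.
  move=> n; have n0 : 0 < n.+1%:R^-1 :> R by rewrite invr_gt0.
  by have [_ [k Kk <-] lt] := inf_adherent n0 infS; exists k.
pose w n := v - k n.
have [e e0|w' w'P] := @l2_complete _ _ _ w.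
  have e4 : 0 < e ^+ 2 / 4 by rewrite divr_gt0// exprn_gt0.
  have [N NP] := small_invn e4.
  exists N => n j Nn Nj.
  rewrite -ler_sqr ?nnegrE ?l2norm_ge0 ?(ltW e0)// parallelogram.
  have Km : K ((2^-1 : C) *: (k n + k j)).
    apply: linear_subspaceZ => //; rewrite -[k n]scale1r.
    by apply: KZ; [case: (kP n)|case: (kP j)].
  have := infD _ Km.
  have -> : l2norm (w n + w j) = 2 * l2norm (v - (2^-1 : C) *: (k n + k j)).
    rewrite (_ : w n + w j = (2 : R)%:C *: (v - (2^-1 : C) *: (k n + k j))).
      by rewrite l2normZr ger0_norm.
    rewrite scalerBr scalerA rmorph_nat divff ?pnatr_eq0// scale1r.
    by rewrite scaler_nat mulr2n addrACA opprD.
  have [_] := kP n; have [_] := kP j; rewrite -/(w n) -/(w j).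
  rewrite exprMn; move: (NP _ Nn) (NP _ Nj).
  have arith (s t A B I X e2 : R) : s < e2 / 4 -> t < e2 / 4 -> A < I + t ->
    B < I + s -> I <= X -> 2 * B + 2 * A - 2 ^+ 2 * X <= e2 by lra.
  exact: arith.
have w'0 : w' = 0.
  apply/eqP; apply: contraT => /closer[h Kh lt].
  pose d := (l2norm w' - l2norm (w' - h)) / 3.
  have d0 : 0 < d by rewrite divr_gt0// subr_gt0.
  have [N NP] := w'P d d0.
  have [M MP] := small_invn (exprn_gt0 2 d0).
  pose n := maxn N M.
  have {}NP := NP n (leq_maxl _ _); have {}MP := MP n (leq_maxr _ _).
  have [Kn] := kP n; rewrite -/(w n) => wn.
  have := infD (k n + h); rewrite opprD addrA -/(w n) => /(_ _).
  have Knh : K (k n + h) by rewrite -[k n]scale1r; exact: KZ.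
  move=> /(_ Knh) wnh.
  have le1 : l2norm (w n - h) <= d + l2norm (w' - h).
    exact: le_trans (l2norm_triangle w' (w n) h) (lerD NP (lexx _)).
  have le2 : l2norm w' <= d + l2norm (w n).
    have := l2norm_triangle (w n) w' 0; rewrite !subr0 => /le_trans; apply.
    by rewrite lerD2r l2normB.
  have dE : l2norm w' - l2norm (w' - h) = d * 3 by rewrite divfK.
  have := gap_absurd (l2norm_ge0 (w n - h)) le1 le2 dE d0 wnh wn MP.
  by [].
move=> e e0; have e2 : 0 < e / 2 by rewrite divr_gt0.
have [N NP] := w'P _ e2.
exists (k N); first by case: (kP N).
have := NP N (leqnn N); rewrite w'0 subr0 => /le_lt_trans; apply.
by rewrite gtr_pMr// invf_lt1// ltr1n.
Qed.

(** If k in K is not orthogonal to v, a small multiple of k, with the phase of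
    the inner product removed, is closer to v than 0 is. *)
Lemma dense_of_orthogonal K : linear_subspace K ->
  (forall u, (forall k, K k -> inner k u = 0) -> u = 0) -> dense K.
Proof.
move=> sK orth; apply: dense_of_closer => // v v0.
have [k Kk vk] : exists2 k, K k & inner k v != 0.
  apply: contrapT => no_k; move/eqP: v0; apply; apply: orth => k Kk.
  by apply: contrapT => /eqP kv; apply: no_k; exists k.
(* removing the phase makes the inner product of k' and v real and positive *)
pose k' := (inner k v)^*%C *: k.
have Kk' : K k' by exact: linear_subspaceZ.
have vk' : 0 < rinner v k'.
  rewrite rinnerC /rinner innerZl Re_conjM.
  rewrite exprn_gt0// lt_def normc_ge0 andbT.
  by apply: contraNN vk => /eqP/eq0_normc ->.
(* The minimum over t of ||v - t k'|| is at <v, k'> / ||k'||^2; adding 1 keeps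
   the denominator positive and t below twice that value. *)
pose t := rinner v k' / (l2norm k' ^+ 2 + 1).
have D0 : 0 < l2norm k' ^+ 2 + 1 by have := sqr_ge0 (l2norm k'); lra.
have t0 : 0 < t by rewrite divr_gt0.
have tD : t * (l2norm k' ^+ 2 + 1) = rinner v k' by rewrite divfK ?gt_eqF.
exists (t%:C *: k'); first exact: linear_subspaceZ.
rewrite -ltr_sqr ?nnegrE ?l2norm_ge0// -scaleNr -rmorphN l2norm_sqrD.
rewrite rinnerZr l2normZr normrN gtr0_norm// exprMn; nra.
Qed.

(** The triangle inequalities of the next lemma combined, with z the distance
    from v to f, r the distance from f to k, x the distance from v to k, and y, t
    the norms of f and v. *)
Lemma perturb_arith (x y z r t e q : R) : z < e -> x <= z + r -> y <= z + t ->
  r <= q * y -> 4 * e = (1 - q) * t -> 0 <= q -> q < 1 -> 0 < e -> x < t.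
Proof.
move=> ze xr yt rq et q0 q1 e0.
have : q * y <= q * (e + t) by rewrite ler_wpM2l//; lra.
have : q * e <= e by rewrite ler_piMl ?ltW.
lra.
Qed.

(** Approximate v by f in J, then f by k in K: the error is at most about
    q ||v||, hence k is closer to v than 0 is. *)
Lemma dense_perturbation (J K : set E) (q : R) : q < 1 ->
  (forall f, J f -> exists2 k, K k & l2norm (f - k) <= q * l2norm f) ->
  linear_subspace K -> dense J -> dense K.
Proof.
move=> q1 JK sK /dense_l2P dJ; apply: dense_of_closer => // v v0.
have nv0 : 0 < l2norm v.
  by rewrite lt_def l2norm_ge0 andbT; apply: contraNN v0 => /eqP/l2norm_eq0 ->.
(* the estimates below multiply by the constant, so it must not be negative *)
pose q' := Num.max q 0.
have q'1 : q' < 1 by rewrite gt_max q1 ltr01.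
have q'0 : 0 <= q' by rewrite le_max lexx orbT.
pose e := (1 - q') * l2norm v / 4.
have e0 : 0 < e by rewrite divr_gt0// mulr_gt0// subr_gt0.
have [f Jf vf] := dJ v e e0; have [k Kk t3] := JK f Jf; exists k => //.
have t1 := l2norm_triangle f v k.
have := l2norm_triangle v f 0; rewrite !subr0 l2normB => t2.
have t4 : q * l2norm f <= q' * l2norm f.
  by rewrite ler_wpM2r ?l2norm_ge0// le_max lexx.
have t5 : 4 * e = (1 - q') * l2norm v by rewrite /e; field.
apply: perturb_arith vf t1 t2 (le_trans t3 t4) t5 q'0 q'1 e0.
Qed.

End density.

(** * Accretive operators and their closures *)

Section accretive_operators.
Context (R : realType) (V : countType) (b : wdigraph R V).
Local Notation C := R[i].
Local Notation E := (l2 b).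
Implicit Types (f g h u v : E) (A : set (E * E)).

Lemma eq0_of_le_eps (x K : R) : 0 <= x -> 0 <= K ->
  (forall e, 0 < e -> x <= e * K) -> x = 0.
Proof.
move=> x0 K0 xe; apply/eqP; rewrite eq_le x0 andbT leNgt; apply/negP => xgt0.
have K1 : 0 < 2 * (K + 1) by lra.
have := xe _ (divr_gt0 xgt0 K1); rewrite mulrAC ler_pdivlMr//.
have : 0 <= x * K by rewrite mulr_ge0.
lra.
Qed.

Lemma closure_linear A : linear_operator A ->
  (closure A) 0 /\
  forall (c : C) p q, closure A p -> closure A q -> closure A (c *: p + q).
Proof.
move=> [A0 AZ _]; split; first exact: subset_closure.
move=> c p q /closure_pairP Ap /closure_pairP Aq; apply/closure_pairP => e e0.
have n0 := normc_ge0 c.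
have n1 : 0 < normc c + 1 by lra.
pose d := e / (normc c + 1).
have d0 : 0 < d by rewrite divr_gt0.
have near f f' g g' : l2norm (f - f') < d -> l2norm (g - g') < d ->
    l2norm ((c *: f + g) - (c *: f' + g')) < e.
  move=> ff' gg'; rewrite opprD addrACA -scalerBr.
  apply: le_lt_trans (l2normD _ _) _; rewrite l2normZ.
  have -> : e = normc c * d + d by rewrite /d; field; rewrite gt_eqF.
  by rewrite ler_ltD// ler_wpM2l// ltW.
have [p' [Ap' p1 p2]] := Ap _ d0; have [q' [Aq' q1 q2]] := Aq _ d0.
by exists (c *: p' + q'); split; [exact: AZ|exact: near|exact: near].
Qed.

Lemma closure_rinner_ge0 A : (forall p, A p -> 0 <= rinner p.2 p.1) ->
  forall p, closure A p -> 0 <= rinner p.2 p.1.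
Proof.
move=> A0 p /closure_pairP Ap; rewrite leNgt; apply/negP => lt0.
(* An e-close point of the graph changes the form by at most
   e (||p.1|| + 1) + e ||p.2||, which for this e is at most half of its
   absolute value. *)
pose K := l2norm p.1 + l2norm p.2 + 1.
have K0 : 0 < K by rewrite ltr_pwDr// addr_ge0 ?l2norm_ge0.
pose e := Num.min 1 (- rinner p.2 p.1 / (2 * K)).
have e0 : 0 < e by rewrite lt_min ltr01/= divr_gt0 ?oppr_gt0 ?mulr_gt0.
have eK : e * (2 * K) <= - rinner p.2 p.1.
  by rewrite -ler_pdivlMr ?mulr_gt0// ge_min lexx orbT.
have e1 : e <= 1 by rewrite ge_min lexx.
have [q [Aq q1 q2]] := Ap e e0.
have split_form : rinner q.2 q.1 = rinner p.2 p.1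
    + rinner (q.2 - p.2) q.1 + rinner p.2 (q.1 - p.1).
  by rewrite rinnerBl rinnerBr; ring.
have le1 : rinner (q.2 - p.2) q.1 <= e * (l2norm p.1 + 1).
  apply: le_trans (rinner_le _ _) _; apply: ler_pM; rewrite ?l2norm_ge0//.
    by rewrite l2normB ltW.
  have := l2norm_triangle p.1 q.1 0; rewrite !subr0 l2normB => /le_trans; apply.
  by rewrite addrC lerD2l (le_trans (ltW q1)).
have le2 : rinner p.2 (q.1 - p.1) <= e * l2norm p.2.
  apply: le_trans (rinner_le _ _) _.
  by rewrite mulrC ler_wpM2r ?l2norm_ge0// l2normB ltW.
have := A0 _ Aq; rewrite split_form.
have : 0 < e * K by rewrite mulr_gt0.
rewrite /K in eK *; lra.
Qed.

(** Both sides of the adjunction identity are continuous in the graph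
    variable. *)
Lemma closure_adjoint A p : adjoint A p -> adjoint (closure A) p.
Proof.
move=> aA q /closure_pairP Aq.
set z := inner q.2 p.1 - inner q.1 p.2.
suff /eq0_normc/eqP : normc z = 0 by rewrite subr_eq0 => /eqP.
apply: (@eq0_of_le_eps _ (l2norm p.1 + l2norm p.2)).
- exact: normc_ge0.
- by rewrite addr_ge0 ?l2norm_ge0.
move=> e e0; have [q' [Aq' q1 q2]] := Aq e e0.
have -> : z = inner (q.2 - q'.2) p.1 - inner (q.1 - q'.1) p.2.
  by rewrite !innerBl (aA _ Aq') /z; ring.
apply: le_trans (le_normcD _ _) _; rewrite normcN mulrDr.
by apply: lerD; apply: le_trans (normc_inner_le _ _) _;
  rewrite ler_wpM2r ?l2norm_ge0// ltW.
Qed.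

(** The point is closability.  If (0, k) is in the closure of the graph, adding
    arbitrary real multiples of it to an element (f, g) of the graph preserves
    Re <g, f> >= 0, which forces Re <k, f> = 0; as such f are dense, k = 0. *)
Lemma accretive_closure A : accretive A -> dense (op_dom A) ->
  accretive (closure A).
Proof.
move=> [lA A0] /dense_l2P dA.
have [c0 cZ] := closure_linear lA.
have cA0 : forall p, closure A p -> 0 <= rinner p.2 p.1.
  by apply: closure_rinner_ge0 => -[f g]; exact: A0.
split; last by move=> f g /cA0.
split => // f g h fg fh.
have gh : closure A (0, g - h).
  have := cZ (-1) _ _ fh fg; congr closure.
  by apply: injective_projections; rewrite /= scaleN1r addrC ?subrr.
set k := g - h in gh; apply/eqP; rewrite -subr_eq0 -/k; apply/eqP.
have ortho p : A p -> rinner k p.1 = 0.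
  move=> Ap; have pos (t : R) : 0 <= rinner p.2 p.1 + t * rinner k p.1.
    have := cA0 _ (cZ t%:C _ _ gh (subset_closure Ap)).
    by rewrite /= scaler0 add0r addrC rinnerDl rinnerZl addrC.
  set x := rinner p.2 p.1 in pos; set y := rinner k p.1 in pos *.
  apply/eqP; apply: contraT => y0.
  (* this multiple would make the form equal to -1 *)
  have := pos (- (x + 1) / y); rewrite divfK//; lra.
apply: l2norm_eq0.
apply: (@eq0_of_le_eps _ 1) => // [|e e0]; first exact: l2norm_ge0.
rewrite mulr1; have [f' [g' Afg] kf] := dA k e e0.
have /(ortho _)/= o := Afg.
have [->|k0] := eqVneq (l2norm k) 0; first exact: ltW.
have {}k0 : 0 < l2norm k by rewrite lt_def k0 l2norm_ge0.
rewrite -(ler_pM2l k0) -expr2 -rinner_norm.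
have -> : rinner k k = rinner k (k - f').
  by rewrite rinnerBr o subr0.
by apply: le_trans (rinner_le _ _) _; rewrite ler_wpM2l ?l2norm_ge0// ltW.
Qed.

Definition shifted_range A (z : C) : set E := [set p.2 + z *: p.1 | p in A].

Lemma linear_subspace_shifted_range A (z : C) : linear_operator A ->
  linear_subspace (shifted_range A z).
Proof.
move=> [A0 AZ _]; split.
  by exists (0 : E * E) => //=; rewrite scaler0 addr0.
move=> c _ _ [p Ap <-] [q Aq <-]; exists (c *: p + q); first exact: AZ.
by rewrite /= !scalerDr !scalerA (mulrC z) addrACA.
Qed.

(** Cauchy-Schwarz applied to Re <(A + z) f, f> >= Re z ||f||^2. *)
Lemma accretive_norm_le A (z : C) p : accretive A -> A p ->
  complex.Re z * l2norm p.1 <= l2norm (p.2 + z *: p.1).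
Proof.
move=> [_ A0]; case: p => f g /= Afg; have {}A0 := A0 _ _ Afg.
have [->|f0] := eqVneq (l2norm f) 0; first by rewrite mulr0 l2norm_ge0.
have {}f0 : 0 < l2norm f by rewrite lt_def f0 l2norm_ge0.
rewrite -(ler_pM2r f0) -mulrA -expr2; apply: le_trans (rinner_le _ _).
have zf : rinner (z *: f) f = complex.Re z * l2norm f ^+ 2.
  by rewrite /rinner innerZl inner_norm complexReM /= mulr0 subr0.
rewrite rinnerDl zf.
by rewrite lerDr.
Qed.

(** The vectors (A + t) f and (A + z) f differ by |z - t| ||f||, which is at
    most |z - t| / t times the norm of the first one. *)
Lemma dense_shifted_range A (t : R) (z : C) : accretive A -> 0 < t ->
  normc (z - t%:C) < t ->
  dense (shifted_range A t%:C) -> dense (shifted_range A z).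
Proof.
move=> accA t0 zt.
apply: (@dense_perturbation _ _ _ _ _ (normc (z - t%:C) / t)).
- by rewrite ltr_pdivrMr// mul1r.
- move=> _ [p Ap <-]; exists (p.2 + z *: p.1); first by exists p.
  have -> : p.2 + t%:C *: p.1 - (p.2 + z *: p.1) = - ((z - t%:C) *: p.1).
    by rewrite opprD addrACA subrr add0r scalerBl opprB.
  rewrite l2normN l2normZ -mulrA ler_wpM2l ?normc_ge0//.
  by rewrite mulrC ler_pdivlMr// mulrC; exact: (@accretive_norm_le A t%:C).
- by apply: linear_subspace_shifted_range; case: accA.
Qed.

(** For z = x + iy, the condition |z - t| < t reads x^2 + y^2 < 2 t x, which
    holds for all large t. *)
Lemma dense_shifted_range_halfplane A (T : R) : accretive A ->
  (forall t : R, T <= t -> 0 < t -> dense (shifted_range A t%:C)) ->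
  forall z : C, 0 < complex.Re z -> dense (shifted_range A z).
Proof.
move=> accA dA [x y] /= x0.
pose t := Num.max (Num.max T 1) ((x ^+ 2 + y ^+ 2) / x).
have tT : T <= t by rewrite !le_max lexx.
have t1 : 1 <= t by rewrite !le_max lexx orbT.
have tx : x ^+ 2 + y ^+ 2 <= t * x.
  by rewrite -ler_pdivrMr// /t le_max lexx orbT.
have t0 : 0 < t by lra.
apply: (@dense_shifted_range _ t) => //; last exact: dA.
rewrite -ltr_sqr ?nnegrE ?normc_ge0 ?(ltW t0)// normc_sqr /= oppr0 addr0.
have : 0 < t * x by rewrite mulr_gt0.
rewrite sqrrB; lra.
Qed.

(** Approximate solutions f of (A + z) f = g converge, because the difference of
    two of them is controlled by the difference of their images. *)
Lemma closure_shift_onto A (z : C) g : accretive A -> 0 < complex.Re z ->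
  dense (shifted_range A z) -> exists2 p, closure A p & p.2 + z *: p.1 = g.
Proof.
move=> accA z0 /dense_l2P dA; have [[A0 AZ _] _] := accA.
have /choice[p pP] : forall n : nat, exists p, A p /\
    l2norm (g - (p.2 + z *: p.1)) < n.+1%:R^-1.
  move=> n; have n0 : 0 < n.+1%:R^-1 :> R by rewrite invr_gt0.
  by have [_ [p Ap <-] lt] := dA g _ n0; exists p.
have close e : 0 < e -> exists N, forall n, (N <= n)%N ->
    l2norm (g - ((p n).2 + z *: (p n).1)) < e.
  move=> /small_invn[N NP]; exists N => n /NP; apply: lt_trans.
  by case: (pP n).
have [e e0|f fP] := @l2_complete _ _ _ (fun n => (p n).1).
  have e0' : 0 < complex.Re z * e / 2 by rewrite divr_gt0// mulr_gt0.
  have [N NP] := close _ e0'; exists N => n k Nn Nk.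
  have App : A (p n - p k).
    rewrite addrC -scaleN1r; apply: AZ; first by case: (pP k).
    by case: (pP n).
  have := accretive_norm_le z accA App.
  set q := p n - p k.
  have -> : q.2 + z *: q.1 =
      ((p n).2 + z *: (p n).1) - ((p k).2 + z *: (p k).1).
    by rewrite /q /= scalerBr opprD addrACA.
  move=> /le_trans/(_ (l2norm_triangle g _ _)) le.
  rewrite -(ler_pM2l z0); apply: le_trans le _.
  by rewrite l2normB [leRHS]splitr; apply: lerD; apply: ltW; exact: NP.
exists (f, g - z *: f); last by rewrite /= subrK.
apply/closure_pairP => e e0 /=.
have n1 : 0 < normc z + 1 by have := normc_ge0 z; lra.
have e1 : 0 < e / 2 by rewrite divr_gt0.
have e2 : 0 < e / 2 / (normc z + 1) by rewrite divr_gt0.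
have [N NP] := fP _ e2; have [M MP] := close _ e1.
have {}NP := NP _ (leq_maxl N M); have {}MP := MP _ (leq_maxr N M).
set n := maxn N M in NP MP.
have fn : (normc z + 1) * l2norm (f - (p n).1) <= e / 2.
  by rewrite mulrC -ler_pdivlMr// l2normB.
have nf := l2norm_ge0 (f - (p n).1); have nz := normc_ge0 z.
have zf : 0 <= normc z * l2norm (f - (p n).1) by rewrite mulr_ge0.
exists (p n); split; first by case: (pP n).
  by move: fn; rewrite mulrDl mul1r; lra.
have -> : g - z *: f - (p n).2 =
    (g - ((p n).2 + z *: (p n).1)) - z *: (f - (p n).1).
  by rewrite scalerBr opprB opprD [g + (_ + _)]addrA subrKA addrAC.
apply: le_lt_trans (l2normD _ _) _; rewrite l2normN l2normZ.
by move: fn; rewrite mulrDl mul1r; lra.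
Qed.

Lemma m_accretive_closure A (T : R) : accretive A -> dense (op_dom A) ->
  (forall t : R, T <= t -> 0 < t -> dense (shifted_range A t%:C)) ->
  m_accretive (closure A).
Proof.
move=> accA dA rA; have accC := accretive_closure accA dA.
have norm_inv (z : C) : 0 < complex.Re z ->
    (opnorm (op_inv (op_add_scalar (closure A) z)) <= (1 / complex.Re z)%:E)%E.
  move=> z0; apply: ge_ereal_sup => _ [_ [[_ [p Ap <-] <-] /= n1] <-].
  rewrite lee_fin ler_pdivlMr// mulrC.
  exact: le_trans (accretive_norm_le z accC Ap) n1.
split => // z /= z0.
have Nz0 : 0 < complex.Re (- z) by case: z z0 => x y /=; rewrite oppr_gt0.
split; last exact: le_lt_trans (norm_inv _ Nz0) (ltry _).
move=> g; have rz := dense_shifted_range_halfplane accA rA Nz0.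
have [[f h] Ap gE] := closure_shift_onto g accA Nz0 rz.
exists f; split; first by exists (f, h); rewrite //= gE.
move=> f' [[f'' h'] Ap' [eqf eqg]]; rewrite -eqf {eqf}.
apply/eqP; rewrite -subr_eq0; apply/eqP/l2norm_eq0.
have [[_ cZ _] _] := accC.
have := accretive_norm_le (- z) accC (cZ (-1) _ _ Ap' Ap).
set q := _ + _; have -> : q.2 + - z *: q.1 = 0.
  rewrite /q /= !scaleN1r scalerDr addrACA scalerN -opprD.
  by move: gE eqg => /= -> ->; rewrite addNr.
have -> : q.1 = f - f'' by rewrite /q /= scaleN1r addrC.
rewrite l2norm0 pmulr_rle0// => le0.
by apply/eqP; rewrite eq_le le0 l2norm_ge0.
Qed.

Lemma dense_op_dom_closure A : dense (op_dom (closure A)) -> dense (op_dom A).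
Proof.
move=> /dense_l2P dA; apply/dense_l2P => v e e0.
have e2 : 0 < e / 2 by rewrite divr_gt0.
have [f [g /closure_pairP/(_ _ e2)[[f' g'] [Afg ff' _]]] vf] := dA v _ e2.
exists f'; first by exists g'.
apply: le_lt_trans (l2norm_triangle f v f') _.
by rewrite [ltRHS]splitr ltrD.
Qed.

(** A vector u orthogonal to the range of A + t is an eigenvector of the
    adjoint, with eigenvalue - t, unless it is 0; but the adjoint is the closure
    of A, whose form is nonnegative. *)
Lemma dense_shifted_range_esa A (t : R) : accretive A ->
  essentially_self_adjoint A -> 0 < t -> dense (shifted_range A t%:C).
Proof.
move=> [lA A0] [_ _ adjA] t0.
apply: dense_of_orthogonal; first exact: linear_subspace_shifted_range.
move=> u orth.
have : adjoint A (u, (- t)%:C *: u).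
  move=> q Aq /=; rewrite innerZr conjc_real rmorphN mulNr.
  have := orth (q.2 + t%:C *: q.1); rewrite innerDl innerZl => /(_ _)/eqP.
  by rewrite addr_eq0 => /(_ (ex_intro2 _ _ q Aq erefl))/eqP.
move=> /closure_adjoint; rewrite -adjA => cu.
have := closure_rinner_ge0 _ cu; rewrite rinnerZl rinner_norm mulNr oppr_ge0.
rewrite pmulr_rle0// => le0; apply: l2norm_eq0; apply/eqP.
by rewrite -sqrf_eq0 eq_le sqr_ge0 andbT; apply: le0 => -[f g]; exact: A0.
Qed.

(** Here A is H plus a perturbation k of H f = h, and the relative bound gives
    ||k|| <= (c / t + 2 a) ||(H + t) f||. *)
Lemma dense_shifted_range_relatively_bounded A H (t c a : R) :
  accretive H -> linear_operator A -> 0 < t -> c / t + 2 * a < 1 -> 0 <= c -> 0 <= a ->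
  (forall f h, H (f, h) -> exists k,
    A (f, h + k) /\ l2norm k <= c * l2norm f + a * l2norm h) ->
  dense (shifted_range H t%:C) -> dense (shifted_range A t%:C).
Proof.
move=> accH lA t0 q1 c0 a0 AH.
apply: dense_perturbation q1 _ (linear_subspace_shifted_range _ lA).
move=> _ [[f h] Hfh <-] /=; have [k [Afk kle]] := AH _ _ Hfh.
exists (h + k + t%:C *: f); first by exists (f, h + k).
have -> : h + t%:C *: f - (h + k + t%:C *: f) = - k.
  by rewrite opprD addrACA subrr addr0 opprD addrA subrr add0r.
rewrite l2normN; apply: le_trans kle _.
have fle := accretive_norm_le t%:C accH Hfh; rewrite /= in fle.
set n := l2norm (h + _) in fle *.
have hle : l2norm h <= 2 * n.
  have := l2normD (h + t%:C *: f) (- (t%:C *: f)); rewrite addrK l2normN.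
  rewrite l2normZr gtr0_norm// -/n => /le_trans; apply.
  by rewrite mulr_natl mulr2n lerD2l.
rewrite mulrDl; apply: lerD.
  by rewrite -mulrA ler_wpM2l// mulrC ler_pdivlMr// mulrC.
by rewrite [2 * a]mulrC -mulrA ler_wpM2l.
Qed.

End accretive_operators.

(** * The Laplacian of a directed graph *)

Section laplacian_lemmas.
Context (R : realType) (V : countType).
Local Notation C := R[i].
Implicit Types (b : wdigraph R V) (f g : V -> C).

(** The formal adjoint Laplacian of a graph is the Laplacian of the reversed
    graph, so that facts about the former are instances of facts about the
    latter. *)
Definition reverse_graph b : wdigraph R V :=
  @WDigraph R V (fun x y => b y x) (vweight b)
    (fun x y => edge_weight_ge0 b y x) (edge_weight_diag b) (vweight_gt0 b).

Lemma adjacent_reverse b x y : adjacent (reverse_graph b) x y = adjacent b x y.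
Proof. by rewrite /adjacent orbC. Qed.

Lemma locally_finite_reverse b :
  locally_finite b -> locally_finite (reverse_graph b).
Proof.
by move=> lf x; apply: sub_finite_set (lf x) => y /=; rewrite adjacent_reverse.
Qed.

Lemma kirchhoff_reverse b : kirchhoff b -> kirchhoff (reverse_graph b).
Proof. by move=> kb x; rewrite /= kb. Qed.

Lemma not_adjacent_weight b x y : ~ adjacent b x y -> b x y = 0 /\ b y x = 0.
Proof.
rewrite /adjacent => /negP; rewrite negb_or -!leNgt => /andP[xy yx].
by split; apply/eqP; rewrite eq_le ?xy ?yx edge_weight_ge0.
Qed.

Lemma fsum_finite (M : nmodType) (S : set V) (F : V -> M) : finite_set S ->
  (forall y, ~ S y -> F y = 0) ->
  \sum_(y \in [set: V]) F y = \sum_(y <- fset_set S) F y.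
Proof.
move=> finS F0; rewrite -fsbig_finite//; apply/esym/fsbig_widen => //.
by move=> y [_ /= /F0].
Qed.

(** Over a fixed finite set of vertices the sum over all y becomes an iterated
    sum, to which the algebra of finite sums applies. *)
Lemma lap_sumE b (S : set V) f x : finite_set S ->
  (forall y, adjacent b x y -> S y) ->
  lap b f x = ((vweight b x)^-1)%:C *
    \sum_(y <- fset_set S) (b x y)%:C * (f x - f y).
Proof.
move=> finS xS; rewrite /lap (fsum_finite finS)// => y nSy.
by have [->] := @not_adjacent_weight b x y (fun xy => nSy (xS y xy)); rewrite mul0r.
Qed.

Lemma lap_linear b (c : C) f g : locally_finite b ->
  lap b (c *: f + g) = c *: lap b f + lap b g.
Proof.
move=> lf; apply/funext => x.
transitivity (c * lap b f x + lap b g x) => //.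
rewrite !(@lap_sumE b [set y | adjacent b x y] _ x (lf x))//.
rewrite mulrCA -mulrDr; congr (_ * _); rewrite mulr_sumr -big_split/=.
apply: eq_bigr => y _.
rewrite [(c *: f + g) x]/(c * f x + g x) [(c *: f + g) y]/(c * f y + g y).
by rewrite mulrCA -mulrDr; congr (_ * _); rewrite mulrBr opprD addrACA.
Qed.

(** Since Re ((f x - f y) conj (f x)) >= (|f x|^2 - |f y|^2) / 2, the form is
    bounded below by the sum [form] of b x y (|f x|^2 - |f y|^2) / 2, and this
    vanishes: the coefficient of |f x|^2 is the difference of the out-degree and
    the in-degree of x. *)
Lemma lap_form_ge0 b f : locally_finite b -> kirchhoff b -> fin_supp f ->
  0 <= complex.Re (csum (fun x => (vweight b x)%:C * lap b f x * (f x)^*%C)).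
Proof.
move=> lf kb finf.
pose S := [set x | f x != 0 \/ exists2 y, f y != 0 & adjacent b y x].
have finS : finite_set S by exact: fin_supp_nbr.
have nS x : ~ S x -> f x = 0.
  by move=> nSx; apply/eqP; apply/negP => fx; apply: nSx; left; exact/negP.
have adjS x y : f x != 0 -> adjacent b x y -> S y by move=> fx xy; right; exists x.
pose N x := normc (f x) ^+ 2.
have N0 x : f x = 0 -> N x = 0 by rewrite /N => ->; rewrite normc0 expr0n.
pose form x : R := \sum_(y <- fset_set S) b x y * ((N x - N y) / 2).
have form_le x :
    form x <= complex.Re ((vweight b x)%:C * lap b f x * (f x)^*%C).
  have [fx|fx] := eqVneq (f x) 0.
    rewrite fx conjc0 mulr0 /form N0// -oppr_ge0 -sumrN sumr_ge0// => y _.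
    rewrite -mulrN mulr_ge0 ?edge_weight_ge0// sub0r mulNr opprK.
    by rewrite divr_ge0 ?sqr_ge0.
  rewrite (lap_sumE f finS (adjS x ^~ fx)) mulrA -rmorphM divff ?gt_eqF ?vweight_gt0//.
  rewrite mul1r mulr_suml (big_morph _ (@complexReD R) (erefl : complex.Re 0 = 0)).
  apply: ler_sum => y _; rewrite -mulrA complexReM /= mul0r subr0.
  rewrite ler_wpM2l ?edge_weight_ge0// /N !normc_sqr.
  case: (f x) (f y) => [u v] [u' v'] /=.
  have := sqr_ge0 (u - u'); have := sqr_ge0 (v - v'); rewrite !sqrrB; lra.
have form0 : \sum_(x <- fset_set S) form x = 0.
  have -> : \sum_(x <- fset_set S) form x =
     \sum_(x <- fset_set S) (\sum_(y <- fset_set S) b x y) * (N x / 2)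
   - \sum_(x <- fset_set S) (\sum_(y <- fset_set S) b y x) * (N x / 2).
    under [X in _ = X - _]eq_bigr do rewrite mulr_suml.
    under [X in _ = _ - X]eq_bigr do rewrite mulr_suml.
    rewrite [X in _ = _ - X]exchange_big/= -sumrB; apply: eq_bigr => x _.
    by rewrite -sumrB; apply: eq_bigr => y _; ring.
  rewrite -sumrB big1// => x _; have [fx|fx] := eqVneq (f x) 0.
    by rewrite N0// mul0r !mulr0 subr0.
  have wS y : ~ S y -> b x y = 0 /\ b y x = 0.
    by move=> nSy; apply: not_adjacent_weight => xy; apply: nSy; exact: adjS xy.
  by rewrite -!fsum_finite ?kb ?subrr// => y /wS[].
rewrite /csum /= (rsum_fin finS); last by move=> x /nS ->; rewrite conjc0 mulr0.
by rewrite fsbig_finite//= -[X in X <= _]form0; apply: ler_sum => x _; exact: form_le.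
Qed.

Lemma lap'_linear b (c : C) f g : locally_finite b ->
  lap' b (c *: f + g) = c *: lap' b f + lap' b g.
Proof.
by move=> lf; apply: (@lap_linear (reverse_graph b)); exact: locally_finite_reverse.
Qed.

Lemma sym_part_linear b (c : C) f g : locally_finite b ->
  sym_part b (c *: f + g) = c *: sym_part b f + sym_part b g.
Proof.
move=> lf; rewrite /sym_part lap_linear// lap'_linear//.
by rewrite addrACA -scalerDr [LHS]scalerDr !scalerA mulrC.
Qed.

Lemma sym_part_add_skew_part b f : sym_part b f + skew_part b f = lap b f.
Proof.
apply/funext => x.
transitivity (2^-1 * (lap b f x + lap' b f x) + 2^-1 * (lap b f x - lap' b f x) : C) => //.
by rewrite -mulrDr addrACA subrr addr0 -mulr2n -(mulr_natl (lap b f x)) mulKf ?pnatr_eq0.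
Qed.

Lemma op_on_Cc_linear b T : (forall (c : C) f g, T (c *: f + g) = c *: T f + T g) ->
  linear_operator (op_on_Cc b T).
Proof.
move=> linT; split.
- split; first by rewrite /fin_supp [X in finite_set X](_ : _ = set0)//;
    apply/seteqP; split => // x /=; rewrite eqxx.
  have := linT (-1) 0 0; rewrite scaleN1r oppr0 addr0 => ->.
  by rewrite scaleN1r addNr.
- move=> c [f Tf] [g Tg] [/= finf Tfe] [/= fing Tge]; split => /=.
    apply: (@sub_finite_set _ _ ([set x | f x != 0] `|` [set x | g x != 0])).
      move=> x /=; have [fx|] := eqVneq (f x) 0; last by left.
      have [gx|] := eqVneq (g x) 0; last by right.
      move=> /eqP; case; transitivity (c * f x + g x) => //.
      by rewrite fx gx mulr0 addr0.
    by rewrite finite_setU.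
  by rewrite linT -Tfe -Tge.
- move=> f g h [_ /= gT] [_ /= hT]; apply: val_inj => /=; by rewrite gT hT.
Qed.

End laplacian_lemmas.

Lemma accretive_lap (R : realType) (V : countType) (b : wdigraph R V) :
  locally_finite b -> kirchhoff b -> accretive (op_on_Cc b (lap b)).
Proof.
move=> lf kb; split; first by apply: op_on_Cc_linear => c f g; exact: lap_linear.
move=> f g [/= finf gE]; rewrite /inner gE.
exact: lap_form_ge0.
Qed.

Lemma accretive_sym_part (R : realType) (V : countType) (b : wdigraph R V) :
  locally_finite b -> kirchhoff b -> accretive (op_on_Cc b (sym_part b)).
Proof.
move=> lf kb; split; first by apply: op_on_Cc_linear => c f g; exact: sym_part_linear.
move=> f g [/= finf gE].
have [fin1 fin2 _ _] := fin_supp_lap lf finf.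
pose u : l2 b := L2 (fin_supp_l2 b fin1); pose v : l2 b := L2 (fin_supp_l2 b fin2).
have -> : g = (2^-1 : R)%:C *: (u + v).
  by apply: val_inj; rewrite /= gE /sym_part fmorphV rmorph_nat.
change (0 <= rinner ((2^-1 : R)%:C *: (u + v)) f).
rewrite rinnerZl mulr_ge0 ?invr_ge0// rinnerDl addr_ge0//.
  exact: lap_form_ge0.
apply: (@lap_form_ge0 _ _ (reverse_graph b)) => //.
  exact: locally_finite_reverse.
exact: kirchhoff_reverse.
Qed.

Theorem theorem3p1p5 (R : realType) (V : countType) (b : wdigraph R V)
  (V_infinite : infinite_set [set: V])
  (b_locally_finite : locally_finite b)
  (b_connected : weakly_connected b)
  (b_outdegree : pos_outdegree b)
  (b_kirchhoff : kirchhoff b)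
  (H_esa : essentially_self_adjoint (op_on_Cc b (sym_part b)))
  (B_bounded : relatively_bounded_lt (op_on_Cc b (skew_part b))
                 (op_on_Cc b (sym_part b)) (2^-1)) :
  m_accretive (closure (op_on_Cc b (lap b))).
Proof.
have [c [a [c0 a0 a2 Bb]]] := B_bounded.
have accD := accretive_lap b_locally_finite b_kirchhoff.
have accH := accretive_sym_part b_locally_finite b_kirchhoff.
have fin := fin_supp_lap b_locally_finite.
have domE : op_dom (op_on_Cc b (lap b)) = op_dom (op_on_Cc b (sym_part b)).
  by rewrite !op_dom_Cc// => f /fin[].
have e0 : 0 < 1 - 2 * a by lra.
(* From this threshold on c / t <= (1 - 2 a) / 2, so that the relative bound
   c / t + 2 a is at most 1 / 2 + a < 1. *)
apply: (@m_accretive_closure _ _ _ _ (2 * c / (1 - 2 * a))) => //.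
  by rewrite domE; apply: dense_op_dom_closure; case: H_esa.
move=> t tc t0.
apply: (dense_shifted_range_relatively_bounded accH _ t0 _ (ltW c0) (ltW a0)).
- by case: accD.
- move: tc; rewrite ler_pdivrMr// => tc.
  have : c / t <= (1 - 2 * a) / 2 by rewrite ler_pdivrMr//; lra.
  lra.
- move=> f h [/= finf hE]; have [_ _ _ fin4] := fin _ finf.
  pose k : l2 b := L2 (fin_supp_l2 b fin4).
  exists k; split; last exact: Bb.
  by split => //=; rewrite hE sym_part_add_skew_part.
- exact: dense_shifted_range_esa.
Qed.
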